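(* Let $n\ge 1$, let $\lambda\vdash n$, and let $r\ge 0$ be an integer. Then: (1) $\lambda\in L_r(n)$ if and only if $\max\{s(\lambda),t(\lambda)\}=r$; (2) $\mathrm{dim}_{\mathrm{loc}}(\lambda)\ge r$ if and only if $s(\lambda)\ge r$ or $t(\lambda)\ge r$; (3) $\mathrm{dim}_{\mathrm{loc}}(\lambda)\le r$ if and only if $s(\lambda)\le r$ and $t(\lambda)\le r$.
   Context: $\mathrm{Par}(n)$ is the set of integer partitions of $n$; $\lambda\vdash n$ means $\lambda\in\mathrm{Par}(n)$. The partition graph $G_n$ is the simple graph with vertex set $\mathrm{Par}(n)$ in which two distinct partitions are adjacent if one is obtained from the other by an elementary transfer of one unit between two parts (decrease one part by $1$ and increase another part by $1$, where the increased part may be an empty part of size $0$, i.e. a new part of size $1$ may be created, and a part that becomes $0$ is deleted), followed by reordering. $K_n$ is the clique complex of $G_n$: its simplices are the nonempty cliques $\sigma$ of $G_n$, with $\dim\sigma=|\sigma|-1$. The local simplex dimension of $\lambda\vdash n$ is $\mathrm{dim}_{\mathrm{loc}}(\lambda)=\max\{\dim\sigma:\sigma\text{ a simplex of }K_n,\ \lambda\in\sigma\}$. For $r\ge 0$ the $r$-th simplex layer is $L_r(n)=\{\lambda\vdash n:\mathrm{dim}_{\mathrm{loc}}(\lambda)=r\}$. Star- and top-capacities: a removable corner of $\lambda$ is a cell of its Young diagram whose removal leaves a Young diagram; an addable corner is a cell outside the diagram whose addition gives a Young diagram. For a removable corner $c$ and an addable corner $a$ of $\lambda$, the transfer $\lambda(c\to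 a)$ moves one cell from $c$ to $a$, i.e. lowers the row length in the row of $c$ by $1$ and raises the row length in the row of $a$ by $1$ (possibly a new row), followed by reordering; it is called admissible if the result is a partition of $n$ different from $\lambda$ (equivalently, if the cell set obtained from the diagram of $\lambda$ by deleting $c$ and adding $a$ is itself a Young diagram). Let $A_{\max}(\lambda,c)$ be the set of addable corners $a$ of $\lambda$ such that $\lambda(c\to a)$ is admissible, and $C_{\max}(\lambda,a)$ the set of removable corners $c$ of $\lambda$ such that $\lambda(c\to a)$ is admissible. Set $s(\lambda)=\max_c|A_{\max}(\lambda,c)|$ (maximum over removable corners $c$) and $t(\lambda)=\max_a|C_{\max}(\lambda,a)|$ (maximum over addable corners $a$). *)

(* Defs.v *)
From HB Require Import structures.
From mathcomp Require Import all_boot.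

Set Implicit Arguments.
Unset Strict Implicit.
Unset Printing Implicit Defensive.

(* Partitions are weakly decreasing sequences of positive parts. *)
Definition is_partition (n : nat) (p : seq nat) : bool :=
  [&& sorted geq p, 0 \notin p & sumn p == n].

Record Par (n : nat) : predArgType :=
  MkPar { parts :> seq nat; _ : is_partition n parts }.

HB.instance Definition _ n := [isSub for @parts n].
HB.instance Definition _ n := [Countable of Par n by <:].

Section ParFinite.

Variable n : nat.

Let encode (p : Par n) : {bseq n of 'I_n.+1} := insub_bseq n (map inord p).

Let decode (b : {bseq n of 'I_n.+1}) : option (Par n) := insub (map val b).

Lemma leq_sumn (s : seq nat) (x : nat) : x \in s -> x <= sumn s.
Proof.
elim: s => //= y s IHs; rewrite inE => /predU1P[->|/IHs]; first exact: leq_addr.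
by move=> /leq_trans; apply; apply: leq_addl.
Qed.

Lemma size_leq_sumn (s : seq nat) : 0 \notin s -> size s <= sumn s.
Proof.
elim: s => //= y s IHs; rewrite inE negb_or eq_sym -lt0n => /andP[y0 /IHs].
by move=> h; rewrite -add1n leq_add.
Qed.

Let encodeK : pcancel encode decode.
Proof.
case=> p hp; rewrite /encode /decode /=.
have /and3P[_ p0 /eqP sp] := hp.
have szp : size (map (@inord n) p) <= n by rewrite size_map -sp size_leq_sumn.
rewrite /insub_bseq val_insubd szp -map_comp map_id_in.
  by rewrite (insubT (is_partition n) hp).
by move=> x xp /=; rewrite inordK // ltnS -sp leq_sumn.
Qed.

HB.instance Definition _ := isFinite.Build (Par n) (pcan_enumP encodeK).

End ParFinite.

(* Rows are numbered from 0, so row [size p] is the empty row below the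
   diagram. *)
Definition move_unit (p : seq nat) (i j : nat) : seq nat :=
  sort geq [seq x <- mkseq (fun k => nth 0 p k - (k == i) + (k == j))
                           (size p).+1 | x != 0].

Definition elementary_transfer (p q : seq nat) : bool :=
  [exists i : 'I_(size p), exists j : 'I_(size p).+1,
     (i != j :> nat) && (move_unit p i j == q)].

Section PartitionGraph.

Variable n : nat.
Implicit Types (lam mu : Par n) (sigma : {set Par n}).

Definition adjacent lam mu : bool :=
  (lam != mu) && (elementary_transfer lam mu || elementary_transfer mu lam).

Definition clique sigma : bool :=
  [forall lam in sigma, forall mu in sigma, (lam != mu) ==> adjacent lam mu].

Definition simplex sigma : bool := (sigma != set0) && clique sigma.

Definition dim sigma : nat := #|sigma|.-1.

Definition dim_loc lam : nat :=
  \max_(sigma | simplex sigma && (lam \in sigma)) dim sigma.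

Definition layer (r : nat) : {set Par n} := [set lam | dim_loc lam == r].

(* Cells are pairs (row, column), numbered from 0.  The diagram of a partition
   of n and all its addable corners lie in the square of side n + 1. *)
Definition cell : finType := ('I_n.+1 * 'I_n.+1)%type.

Implicit Types (a c : cell) (D : {set cell}).

Definition is_diagram D : bool :=
  [forall x in D, forall y : cell,
     ((y.1 <= x.1) && (y.2 <= x.2)) ==> (y \in D)].

Definition diagram lam : {set cell} := [set x : cell | x.2 < nth 0 lam x.1].

Definition removable lam c : bool :=
  (c \in diagram lam) && is_diagram (diagram lam :\ c).

Definition addable lam a : bool :=
  (a \notin diagram lam) && is_diagram (a |: diagram lam).

Definition transfer lam c a : seq nat := move_unit lam c.1 a.1.

Definition admissible lam c a : bool :=
  is_partition n (transfer lam c a) && (transfer lam c a != lam).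

Definition A_max lam c : {set cell} :=
  [set a | addable lam a && admissible lam c a].

Definition C_max lam a : {set cell} :=
  [set c | removable lam c && admissible lam c a].

Definition star_capacity lam : nat :=
  \max_(c | removable lam c) #|A_max lam c|.

Definition top_capacity lam : nat :=
  \max_(a | addable lam a) #|C_max lam a|.

End PartitionGraph.

(* Main.v *)
Require Import Defs.
From mathcomp Require Import all_boot.
From mathcomp Require Import zify.

(**
Conjugating, an elementary transfer that changes the partition shortens one
column of the Young diagram by one cell and lengthens another, so [lam] and
[mu] are adjacent iff the diagram of [mu] is that of [lam] with one cell [c]
replaced by a new cell [a]; then [c] is a removable and [a] an addable corner
of [lam], because intersections and unions of diagrams are diagrams.
Two neighbours of [lam], given by [(c, a)] and [(d, b)], are adjacent iff
exactly one of [c = d], [a = b] holds.  Hence the neighbours of [lam] in a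
clique either all share [c] or all share [a].
*)

(** * Row and column lengths of a sequence *)

Lemma geq_trans : transitive geq.
Proof. by move=> y x z /= xy yz; apply: leq_trans xy. Qed.

(** The bound [m] reflects that cells live in a finite square: two row lengths can be compared only
    through columns of index at most [n]. *)
Lemma eq_from_ltn (m x y : nat) : x <= m -> y <= m ->
  (forall z, z <= m -> (z < x) = (z < y)) -> x = y.
Proof. by move=> xm ym xy; have := xy x xm; have := xy y ym; lia. Qed.

(** This is conjugation: [count (ltn y) p] is the length of column [y], so a cell can be tested by
    its row or by its column. *)
Lemma ltn_nth_count (p : seq nat) (k y : nat) :
  sorted geq p -> (y < nth 0 p k) = (k < count (ltn y) p).
Proof.
elim: p k => [|x p IHp] k /=; first by rewrite nth_nil.
rewrite path_sortedE; last exact: geq_trans.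
case/andP=> /allP xp sp; case: (ltnP y x) => yx.
  by case: k => [|k] /=; rewrite ?yx // IHp.
have -> : count (ltn y) p = 0.
  apply/eqP; rewrite -leqn0 leqNgt -has_count; apply/hasPn => z /xp /= zx.
  by rewrite -leqNgt (leq_trans zx).
case: k => [|k] /=; first by rewrite ltnNge yx.
rewrite ltn0 ltnNge; case: (ltnP k (size p)) => kp.
  by rewrite (leq_trans (xp _ (mem_nth 0 kp)) yx).
by rewrite nth_default.
Qed.

Lemma filter_mkseq_nth (p : seq nat) (m : nat) :
  0 \notin p -> size p <= m -> [seq x <- mkseq (nth 0 p) m | x != 0] = p.
Proof.
move=> p0 pm; rewrite -(subnKC pm) /mkseq iotaD map_cat filter_cat add0n.
rewrite -[map _ (iota 0 _)]/(mkseq _ _) mkseq_nth (eq_in_filter (a2 := predT)).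
  rewrite filter_predT -[RHS]cats0; congr cat.
  apply/eqP; rewrite -size_eq0 size_filter -leqn0 leqNgt -has_count.
  apply/hasPn => x /mapP[k]; rewrite mem_iota => /andP[pk _] ->.
  by rewrite nth_default.
by move=> x xp; apply/eqP => x0; rewrite -x0 xp in p0.
Qed.

Lemma sum_change2 (m i j : nat) (f g : nat -> nat) :
    i < m -> j < m -> i != j ->
    (forall k, k != i -> k != j -> f k = g k) ->
  \sum_(k < m) f k + (g i + g j) = \sum_(k < m) g k + (f i + f j).
Proof.
move=> im jm ij fg.
have split2 (h : nat -> nat) : \sum_(k < m) h k =
    h i + (h j + \sum_(k < m | (k != i :> nat) && (k != j :> nat)) h k).
  rewrite (bigD1 (Ordinal im)) //= (bigD1 (Ordinal jm)) /=; last first.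
    by rewrite -val_eqE /= eq_sym.
  by congr (_ + (_ + _)); apply: eq_bigl => k; rewrite -!val_eqE.
rewrite !split2 (eq_bigr (fun k : 'I_m => g k)) => [|k /andP[ki kj]]; last exact: fg.
move: (\sum_(k < m | _) _) => S; lia.
Qed.

Lemma count_mkseq (P : pred nat) (f : nat -> nat) (m : nat) :
  count P (mkseq f m) = \sum_(k < m) P (f k).
Proof.
by rewrite /mkseq count_map -sum1_count big_mkcond /= -(big_mkord predT
  (fun k => P (f k) : nat)) /index_iota subn0; apply: eq_bigr => k _; case: (P _).
Qed.

(** Column lengths ignore the order of the rows and the empty rows, so sorting and filtering drop
    out. Row [i] loses its cell in column [nth 0 p i - 1], row [j] gains one in column [nth 0 p j].
    The additive form avoids truncated subtraction. *)
Lemma count_move_unit (p : seq nat) (i j y : nat) :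
    i < size p -> j <= size p -> i != j -> 0 < nth 0 p i ->
  count (ltn y) (move_unit p i j) + (y.+1 == nth 0 p i)
    = count (ltn y) p + (y == nth 0 p j).
Proof.
move=> ip jp ij pi0; rewrite /move_unit.
set f := fun k => nth 0 p k - (k == i) + (k == j); set s := mkseq f _.
have -> : count (ltn y) (sort geq [seq x <- s | x != 0]) = count (ltn y) s.
  rewrite (permP (permEl (perm_sort _ _))) count_filter.
  by apply: eq_count => -[|x]; rewrite //= andbT.
have -> : count (ltn y) p = count (ltn y) (mkseq (nth 0 p) (size p).+1).
  by rewrite mkseqS mkseq_nth -cats1 count_cat /= nth_default // ltn0 !addn0.
rewrite /s !count_mkseq.
have fE k : k != i -> k != j -> f k = nth 0 p k.
  by move=> ki kj; rewrite /f (negbTE ki) (negbTE kj) subn0 addn0.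
have := @sum_change2 (size p).+1 i j (fun k => ltn y (f k))
  (fun k => ltn y (nth 0 p k)) (leqW ip) jp ij.
move=> /(_ (fun k ki kj => congr1 (fun z => ltn y z : nat) (fE k ki kj))).
rewrite /= /f !eqxx (negbTE ij) eq_sym (negbTE ij).
move: (\sum_(k < _) _) (\sum_(k < _) _) => S T; lia.
Qed.

(** * Diagrams and their corners *)

Section PartitionGraph.

Variable n : nat.
Implicit Types (lam mu nu : Par n) (sigma : {set Par n}) (c a d b : cell n).

Lemma Par_sorted lam : sorted geq lam.
Proof. by case: lam => p /= /and3P[]. Qed.

Lemma Par_notin0 lam : 0 \notin (lam : seq nat).
Proof. by case: lam => p /= /and3P[]. Qed.

Lemma Par_sumn lam : sumn lam = n.
Proof. by case: lam => p /= /and3P[_ _ /eqP]. Qed.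

Lemma Par_size lam : size lam <= n.
Proof. by rewrite -[leqRHS](Par_sumn lam) size_leq_sumn ?Par_notin0. Qed.

Lemma Par_nth_le lam k : nth 0 lam k <= n.
Proof.
case: (ltnP k (size lam)) => k_lam; last by rewrite nth_default.
by rewrite -[leqRHS](Par_sumn lam) leq_sumn ?mem_nth.
Qed.

Lemma Par_nth_gt0 lam k : (0 < nth 0 lam k) = (k < size lam).
Proof.
case: (ltnP k (size lam)) => k_lam; last by rewrite nth_default.
rewrite lt0n; apply: contra (Par_notin0 lam) => /eqP <-; exact: mem_nth.
Qed.

Lemma count_le lam y : count (ltn y) lam <= size lam.
Proof. exact: count_size. Qed.

Lemma in_diagram lam (x : cell n) : (x \in diagram lam) = (x.2 < nth 0 lam x.1).
Proof. by rewrite inE. Qed.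

Lemma in_diagram_count lam (x : cell n) :
  (x \in diagram lam) = (x.1 < count (ltn x.2) lam).
Proof. by rewrite inE ltn_nth_count ?Par_sorted. Qed.

Lemma diagram_inj : injective (@diagram n).
Proof.
move=> lam mu eqD; apply: val_inj => /=.
rewrite -[LHS](@filter_mkseq_nth lam n.+1) ?Par_notin0 ?leqW ?Par_size //.
rewrite -[RHS](@filter_mkseq_nth mu n.+1) ?Par_notin0 ?leqW ?Par_size //.
congr filter; apply/eq_in_map => k; rewrite mem_iota => /andP[_ kn].
have row y : y <= n -> (y < nth 0 lam k) = (y < nth 0 mu k).
  by move=> yn; have /setP/(_ (inord k, inord y)) := eqD;
    rewrite !in_diagram /= !inordK.
exact: eq_from_ltn (Par_nth_le lam k) (Par_nth_le mu k) row.
Qed.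

Lemma is_diagramP (D : {set cell n}) :
  reflect (forall x y : cell n, x \in D -> y.1 <= x.1 -> y.2 <= x.2 -> y \in D)
          (is_diagram D).
Proof.
apply: (iffP forall_inP) => h x => [y /h/forallP/(_ y)/implyP h1 y1 y2|xD].
  by apply: h1; rewrite y1.
by apply/forallP => y; apply/implyP => /andP[]; apply: h.
Qed.

Lemma diagram_is_diagram lam : is_diagram (diagram lam).
Proof.
apply/is_diagramP => x y; rewrite in_diagram => xD y1 y2.
have := leq_ltn_trans y2 xD; rewrite ltn_nth_count ?Par_sorted // => h.
by rewrite in_diagram_count; apply: leq_ltn_trans y1 h.
Qed.

Lemma is_diagramI (D E : {set cell n}) :
  is_diagram D -> is_diagram E -> is_diagram (D :&: E).
Proof.
move=> /is_diagramP hD /is_diagramP hE; apply/is_diagramP => x y.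
rewrite !inE => /andP[xD xE] y1 y2.
by rewrite (hD x y xD y1 y2) (hE x y xE y1 y2).
Qed.

Lemma is_diagramU (D E : {set cell n}) :
  is_diagram D -> is_diagram E -> is_diagram (D :|: E).
Proof.
move=> /is_diagramP hD /is_diagramP hE; apply/is_diagramP => x y.
rewrite !inE => /orP[xD|xE] y1 y2; first by rewrite (hD x y xD y1 y2).
by rewrite (hE x y xE y1 y2) orbT.
Qed.

(** Let [c'] be the bottom cell of the column in which the row of [c] ends. It lies weakly below and
    to the right of [c], so if it were another cell, it would survive the removal of [c] and force
    [c] back into the diagram. *)
Lemma removable_coord lam c : removable lam c ->
  c.2.+1 = nth 0 lam c.1 /\ c.1.+1 = count (ltn c.2) lam.
Proof.
case/andP=> cD /is_diagramP h.
pose c' : cell n :=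
  (inord (count (ltn (nth 0 lam c.1).-1) lam).-1, inord (nth 0 lam c.1).-1).
have c2 : c.2 < nth 0 lam c.1 by rewrite -in_diagram.
have c1 : c.1 < count (ltn (nth 0 lam c.1).-1) lam.
  by rewrite -ltn_nth_count ?Par_sorted //; lia.
have c'2 : c'.2 = (nth 0 lam c.1).-1 :> nat.
  by rewrite inordK //; have := Par_nth_le lam c.1; lia.
have c'1 : c'.1 = (count (ltn (nth 0 lam c.1).-1) lam).-1 :> nat.
  rewrite inordK //; have := count_le lam (nth 0 lam c.1).-1.
  by have := Par_size lam; lia.
have cc' : c = c'.
  apply/eqP/negPn/negP => ncc'.
  have c'D : c' \in diagram lam :\ c.
    by rewrite !inE eq_sym ncc' -in_diagram in_diagram_count c'1 c'2; lia.
  have : c \in diagram lam :\ c by apply: (h c' c c'D); rewrite ?c'1 ?c'2; lia.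
  by rewrite in_setD1 eqxx.
by move: c1 c'1 c'2; rewrite -cc' => c1 e1 e2; rewrite -e2 in c1 e1; lia.
Qed.

(** Dually, [a'] is the first missing cell of the column just past the end of the row of [a]. It
    lies weakly above and to the left of [a], hence in the enlarged diagram, and the only new cell
    there is [a]. *)
Lemma addable_coord lam a : addable lam a ->
  a.2 = nth 0 lam a.1 :> nat /\ a.1 = count (ltn a.2) lam :> nat.
Proof.
case/andP=> aD /is_diagramP h.
pose a' : cell n := (inord (count (ltn (nth 0 lam a.1)) lam), inord (nth 0 lam a.1)).
have a2 : nth 0 lam a.1 <= a.2 by rewrite leqNgt -in_diagram.
have a1 : count (ltn (nth 0 lam a.1)) lam <= a.1.
  by rewrite leqNgt -ltn_nth_count ?Par_sorted // ltnn.
have a'2 : a'.2 = nth 0 lam a.1 :> nat.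
  by rewrite inordK // ltnS Par_nth_le.
have a'1 : a'.1 = count (ltn (nth 0 lam a.1)) lam :> nat.
  by rewrite inordK // ltnS (leq_trans (count_le _ _)) ?Par_size.
have : a' \in a |: diagram lam by apply: (h a); rewrite ?setU11 ?a'1 ?a'2.
rewrite in_setU1 in_diagram_count a'1 a'2 ltnn orbF => /eqP a'a.
by move: a'1 a'2; rewrite a'a => e1 e2; rewrite -e2 in e1.
Qed.

(** * Exchanging one cell of a diagram, and elementary transfers *)

Definition swap lam mu c a :=
  [/\ c \in diagram lam, a \notin diagram lam
    & diagram mu = a |: diagram lam :\ c].

Lemma swap_sym lam mu c a : swap lam mu c a -> swap mu lam a c.
Proof.
case=> cD aD E; split; first by rewrite E setU11.
  by rewrite E !inE eqxx orbF; apply: contra aD => /eqP <-.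
apply/setP => x; rewrite E in_setU1 in_setD1 in_setU1 in_setD1.
case: (eqVneq x c) => [->|] //=; case: (eqVneq x a) => [->|] //=.
by rewrite (negbTE aD).
Qed.

Lemma swap_neq lam mu c a : swap lam mu c a -> lam != mu.
Proof.
by case=> cD aD E; apply: contraNneq aD => ->; rewrite E setU11.
Qed.

Lemma swap_removable lam mu c a : swap lam mu c a -> removable lam c.
Proof.
case=> cD aD E; rewrite /removable cD /=.
have -> : diagram lam :\ c = diagram lam :&: diagram mu.
  apply/setP => x; rewrite E in_setD1 in_setI in_setU1 in_setD1.
  case: (eqVneq x a) => [->|] /=; last by case: (x \in _); rewrite ?andbF.
  by rewrite (negbTE aD) andbF.
by rewrite is_diagramI ?diagram_is_diagram.
Qed.

Lemma swap_addable lam mu c a : swap lam mu c a -> addable lam a.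
Proof.
case=> cD aD E; rewrite /addable aD /=.
have -> : a |: diagram lam = diagram lam :|: diagram mu.
  apply/setP => x; rewrite E [LHS]in_setU1 [RHS]in_setU in_setU1 in_setD1.
  by case: (x == a); case: (x \in _); rewrite ?orbT ?andbF.
by rewrite is_diagramU ?diagram_is_diagram.
Qed.

(** In a common row, [c] would be the last cell of [lam] and the first missing cell of [mu], making
    that row longer in [lam]; the same reasoning for [a] makes it longer in [mu]. *)
Lemma swap_row_neq lam mu c a : swap lam mu c a -> c.1 != a.1.
Proof.
move=> S; have [c2 _] := removable_coord _ _ (swap_removable _ _ _ _ S).
have [a2 _] := addable_coord _ _ (swap_addable _ _ _ _ S).
have [a2' _] := removable_coord _ _ (swap_removable _ _ _ _ (swap_sym _ _ _ _ S)).
have [c2' _] := addable_coord _ _ (swap_addable _ _ _ _ (swap_sym _ _ _ _ S)).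
by apply/eqP => e; rewrite e in c2 c2'; lia.
Qed.

(** At corners the changed rows are already in order: before sorting, the list built by [move_unit]
    consists of the rows of [mu], possibly padded with zeros. *)
Lemma swap_transfer lam mu c a : swap lam mu c a -> transfer lam c a = mu.
Proof.
move=> S; have ne := swap_row_neq _ _ _ _ S.
have S' := swap_sym _ _ _ _ S.
have [c2 _] := removable_coord _ _ (swap_removable _ _ _ _ S).
have [a2 a1] := addable_coord _ _ (swap_addable _ _ _ _ S).
have [a2' _] := removable_coord _ _ (swap_removable _ _ _ _ S').
have [c2' _] := addable_coord _ _ (swap_addable _ _ _ _ S').
have [cD aD E] := S.
have row k : k <= n -> k != c.1 -> k != a.1 -> nth 0 mu k = nth 0 lam k.
  move=> kn kc ka.
  have h y : y <= n -> (y < nth 0 mu k) = (y < nth 0 lam k).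
    move=> yn; have /setP/(_ (inord k, inord y)) := E.
    rewrite in_setU1 in_setD1 !in_diagram /= !inordK // => ->.
    by rewrite -!pair_eqE /pair_eq /= -!val_eqE /= !inordK // (negbTE kc) (negbTE ka).
  exact: eq_from_ltn (Par_nth_le mu k) (Par_nth_le lam k) h.
(* [move_unit] lists only rows [0] to [size lam]. Row [size lam + 1] is empty in [lam] and contains
   neither [c] nor [a], so it is empty in [mu] as well. *)
have mu_size : size mu <= (size lam).+1.
  rewrite leqNgt -Par_nth_gt0; apply/negP => mu0.
  have ln : (size lam).+1 <= n.
    by move: mu0; rewrite Par_nth_gt0; have := Par_size mu; lia.
  have a_le : a.1 <= size lam by rewrite a1 count_le.
  have c_lt : c.1 < size lam by rewrite -Par_nth_gt0 -c2.
  by move: mu0; rewrite row ?nth_default //; lia.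
rewrite /transfer /move_unit (_ : mkseq _ _ = mkseq (nth 0 mu) (size lam).+1).
  rewrite filter_mkseq_nth ?Par_notin0 //.
  apply: sorted_sort; [exact: geq_trans | exact: Par_sorted].
apply/eq_in_map => k; rewrite mem_iota add0n => /andP[_ kn].
have {}kn : k <= n by rewrite (leq_trans _ (Par_size lam)).
case: (eqVneq k c.1) => [->|kc].
  by rewrite -c2 -c2' -val_eqE /= in ne *; rewrite (negbTE ne); lia.
case: (eqVneq k a.1) => [->|ka]; first by rewrite -a2 -a2'; lia.
by rewrite row // subn0 addn0.
Qed.

Lemma swap_admissible lam mu c a : swap lam mu c a -> admissible lam c a.
Proof.
move=> S; rewrite /admissible (swap_transfer _ _ _ _ S) (valP mu) /=.
by rewrite (inj_eq val_inj) eq_sym (swap_neq _ _ _ _ S).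
Qed.

(** Among rows of equal length, sorting moves the loss to the lowest and the gain to the highest. So
    [c] is the bottom cell of column [nth 0 lam i - 1] and [a] the first cell below column
    [nth 0 lam j]; their rows need not be [i] and [j]. The four coordinate equations allow
    [admissible_swap] to recognise these cells. *)
Lemma move_unit_swap lam mu (i j : nat) :
    i < size lam -> j <= size lam -> i != j ->
    move_unit lam i j = mu -> lam != mu ->
  exists c a, [/\ swap lam mu c a,
    c.2.+1 = nth 0 lam i, c.1.+1 = count (ltn c.2) lam,
    a.2 = nth 0 lam j :> nat & a.1 = count (ltn a.2) lam :> nat].
Proof.
move=> il jl ij M ne.
have li0 : 0 < nth 0 lam i by rewrite Par_nth_gt0.
have cnt y := count_move_unit lam i j y il jl ij li0; rewrite M in cnt.
(* In case of equality the transfer only exchanges two row lengths, so no column length changes and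
   [mu] would be [lam]. *)
have nij : (nth 0 lam i).-1 != nth 0 lam j.
  apply: contra_neq ne => e; apply: diagram_inj; apply/setP => x.
  by rewrite !in_diagram_count; have := cnt x.2; lia.
have size_n := Par_size lam.
have [li lj] := (Par_nth_le lam i, Par_nth_le lam j).
pose c : cell n :=
  (inord (count (ltn (nth 0 lam i).-1) lam).-1, inord (nth 0 lam i).-1).
pose a : cell n := (inord (count (ltn (nth 0 lam j)) lam), inord (nth 0 lam j)).
have c2 : c.2 = (nth 0 lam i).-1 :> nat by rewrite inordK //; lia.
have c1 : c.1 = (count (ltn (nth 0 lam i).-1) lam).-1 :> nat.
  by rewrite inordK //; have := count_le lam (nth 0 lam i).-1; lia.
have a2 : a.2 = nth 0 lam j :> nat by rewrite inordK //; lia.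
have a1 : a.1 = count (ltn (nth 0 lam j)) lam :> nat.
  by rewrite inordK //; have := count_le lam (nth 0 lam j); lia.
have pos : i < count (ltn (nth 0 lam i).-1) lam.
  by rewrite -ltn_nth_count ?Par_sorted //; lia.
exists c, a; split; try by rewrite ?c2 ?c1 ?a2 ?a1; lia.
split; rewrite ?in_diagram_count ?c1 ?c2 ?a1 ?a2; [lia | lia |].
apply/setP => x; rewrite in_setU1 in_setD1 !in_diagram_count.
have eqcell (u v : cell n) : (u == v) = (u.1 == v.1 :> nat) && (u.2 == v.2 :> nat).
  by rewrite -pair_eqE.
rewrite !eqcell a1 a2 c1 c2; case: x => k y /=; have := cnt y.
case: (eqVneq (y : nat) (nth 0 lam i).-1) => [->|yi].
  by rewrite (negbTE nij) andbF andbT; lia.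
rewrite andbF /=; case: (eqVneq (y : nat) (nth 0 lam j)) => [->|yj]; lia.
Qed.

Lemma elementary_transfer_swap lam mu :
  elementary_transfer lam mu -> lam != mu -> exists c a, swap lam mu c a.
Proof.
case/existsP=> i /existsP[j /andP[ij /eqP M]] ne.
have [c [a [S _ _ _ _]]] :=
  move_unit_swap lam mu i j (ltn_ord i) (ltn_ord j) ij M ne.
by exists c, a.
Qed.

Lemma adjacentP lam mu : adjacent lam mu <-> exists c a, swap lam mu c a.
Proof.
split=> [/andP[ne /orP[]]|[c [a S]]].
- by move=> /elementary_transfer_swap; apply.
- move=> /elementary_transfer_swap; rewrite eq_sym => /(_ ne)[c [a S]].
  by exists a, c; apply: swap_sym.
rewrite /adjacent (swap_neq _ _ _ _ S) /=; apply/orP; left.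
have [c2 _] := removable_coord _ _ (swap_removable _ _ _ _ S).
have [_ a1] := addable_coord _ _ (swap_addable _ _ _ _ S).
have c_lt : c.1 < size lam by rewrite -Par_nth_gt0 -c2.
have a_lt : a.1 < (size lam).+1 by rewrite ltnS a1 count_le.
apply/existsP; exists (Ordinal c_lt); apply/existsP; exists (Ordinal a_lt) => /=.
by rewrite (swap_row_neq _ _ _ _ S); apply/eqP; apply: swap_transfer S.
Qed.

Lemma admissible_swap lam c a :
    removable lam c -> addable lam a -> admissible lam c a ->
  exists mu, swap lam mu c a.
Proof.
move=> /removable_coord[c2 c1] /addable_coord[a2 a1] /andP[P ne].
pose mu : Par n := MkPar P; exists mu.
have ne' : lam != mu by rewrite -(inj_eq val_inj) eq_sym.
have c_lt : c.1 < size lam by rewrite -Par_nth_gt0 -c2.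
have a_le : a.1 <= size lam by rewrite a1 count_le.
(* In a common row the loss and the gain cancel, since the row of [c] is nonempty, and the transfer
   would return [lam]. *)
have ca : c.1 != a.1 :> nat.
  apply: contra_neq ne' => ca; apply: val_inj => /=.
  rewrite /transfer /move_unit -ca.
  rewrite (_ : mkseq _ _ = mkseq (nth 0 lam) (size lam).+1).
    rewrite filter_mkseq_nth ?Par_notin0 //.
    by rewrite sorted_sort //; [exact: geq_trans | exact: Par_sorted].
  apply/eq_in_map => k _; case: eqVneq => [->|]; last by rewrite subn0 addn0.
  by rewrite -c2; lia.
(* The cells [d] and [b] satisfy the corner equations of [c] and [a], which fix first the column and
   then the row. *)
have [d [b [S d2 d1 b2 b1]]] :=
  move_unit_swap lam mu c.1 a.1 c_lt a_le ca (erefl _) ne'.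
have e2 : d.2 = c.2 by apply/ord_inj/succn_inj/(etrans d2 (esym c2)).
have f2 : b.2 = a.2 by apply: ord_inj (etrans b2 (esym a2)).
have e1 : d.1 = c.1.
  by rewrite e2 in d1; apply/ord_inj/succn_inj/(etrans d1 (esym c1)).
have f1 : b.1 = a.1.
  by rewrite f2 in b1; apply: ord_inj (etrans b1 (esym a1)).
by rewrite (surjective_pairing c) (surjective_pairing a) -e1 -e2 -f1 -f2
  -!surjective_pairing.
Qed.

(** * Adjacency between two neighbours of a partition *)

Lemma swap_inj lam mu nu c a : swap lam mu c a -> swap lam nu c a -> mu = nu.
Proof. by case=> _ _ E [_ _ F]; apply: diagram_inj; rewrite E F. Qed.

Lemma swap_same_removed lam mu nu c a b :
  swap lam mu c a -> swap lam nu c b -> a != b -> swap mu nu a b.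
Proof.
move=> [cD aD E] [_ bD F] ab; split; rewrite ?E ?F ?setU11 //.
  by rewrite in_setU1 in_setD1 (negbTE bD) andbF orbF eq_sym.
apply/setP => x; rewrite !in_setU1 !in_setD1 in_setU1 in_setD1.
by case: (eqVneq x a) => [->|] //=; rewrite (negbTE aD) andbF.
Qed.

Lemma swap_same_added lam mu nu c d a :
  swap lam mu c a -> swap lam nu d a -> c != d -> swap mu nu d c.
Proof.
move=> [cD aD E] [dD _ F] cd; split; rewrite ?E ?F.
- by rewrite in_setU1 in_setD1 (eq_sym d c) cd dD orbT.
- by rewrite in_setU1 in_setD1 eqxx orbF; apply: contraNneq aD => <-.
apply/setP => x; rewrite !in_setU1 !in_setD1 in_setU1 in_setD1.
case: (eqVneq x a) => [->|xa] /=.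
  by rewrite andbT [RHS]orbC; apply/esym/orP; left; apply: contraNneq aD => ->.
by case: (eqVneq x c) => [->|] //=; rewrite cd cD.
Qed.

Lemma swap_adjacent lam mu nu c d a b :
    swap lam mu c a -> swap lam nu d b -> adjacent mu nu ->
  c = d \/ a = b.
Proof.
move=> [cD aD E] [dD bD F] /adjacentP[x [y [_ _ G]]].
case: (eqVneq c d) => [->|cd]; first by left.
case: (eqVneq a b) => [->|ab]; first by right.
(* [mu] contains the cells [a] and [d], neither of which lies in [nu], but only
   [x] can be lost. *)
have lost z : z \in diagram mu -> z \notin diagram nu -> z = x.
  rewrite G in_setU1 in_setD1 negb_or => zm /andP[_].
  by rewrite zm andbT negbK => /eqP.
have ax : a = x.
  apply: lost; first by rewrite E setU11.
  by rewrite F in_setU1 in_setD1 negb_or ab (negbTE aD) andbF.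
have dx : d = x.
  apply: lost; first by rewrite E in_setU1 in_setD1 (eq_sym d c) cd dD orbT.
  rewrite F in_setU1 in_setD1 negb_or eqxx andbT.
  by apply: contraNneq bD => <-.
by rewrite ax -dx dD in aD.
Qed.

Lemma star_capacity_ge lam mu c a (B : {set cell n}) : swap lam mu c a ->
  {subset B <= A_max lam c} -> #|B| <= star_capacity lam.
Proof.
move=> S /subsetP/subset_leq_card/leq_trans; apply.
exact: (@leq_bigmax_cond _ _ (fun c => #|A_max lam c|) _
  (swap_removable _ _ _ _ S)).
Qed.

Lemma top_capacity_ge lam mu c a (B : {set cell n}) : swap lam mu c a ->
  {subset B <= C_max lam a} -> #|B| <= top_capacity lam.
Proof.
move=> S /subsetP/subset_leq_card/leq_trans; apply.
exact: (@leq_bigmax_cond _ _ (fun a => #|C_max lam a|) _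
  (swap_addable _ _ _ _ S)).
Qed.

(** * Upper bound: cliques through a partition *)

Lemma dim_loc_le lam : dim_loc lam <= maxn (star_capacity lam) (top_capacity lam).
Proof.
apply/bigmax_leqP => sigma /andP[/andP[_ cl] lam_sigma].
have {}cl mu nu : mu \in sigma -> nu \in sigma -> mu != nu -> adjacent mu nu.
  by move=> ms ns; apply/implyP; move/forall_inP: cl => /(_ mu ms)/forall_inP; apply.
rewrite /dim (cardsD1 lam) lam_sigma add1n /=.
(* Outside [sigma :\ lam] the pair is a dummy, so that a total choice function [f] can be
   extracted. *)
have ex mu : exists ca : cell n * cell n,
    mu \in sigma :\ lam -> swap lam mu ca.1 ca.2.
  case: (boolP (mu \in sigma :\ lam)) => [|_]; last by exists ((ord0, ord0), (ord0, ord0)).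
  rewrite in_setD1 => /andP[ml ms].
  have /adjacentP[c [a S]] : adjacent lam mu by rewrite cl // eq_sym.
  by exists (c, a).
have [f fP] := fin_all_exists ex.
have share mu nu : mu \in sigma :\ lam -> nu \in sigma :\ lam ->
    (f mu).1 = (f nu).1 \/ (f mu).2 = (f nu).2.
  move=> ms ns; case: (eqVneq mu nu) => [->|mn]; first by left.
  apply: (swap_adjacent lam mu nu); try exact: fP.
  by move: ms ns; rewrite !in_setD1 => /andP[_ ms] /andP[_ ns]; apply: cl.
have [->|[mu0 ms0]] := set_0Vmem (sigma :\ lam); first by rewrite cards0.
rewrite leq_max.
case: (boolP [forall mu in sigma :\ lam, (f mu).1 == (f mu0).1]).
  move/forall_inP => same; apply/orP; left.
  (* With the removed cell fixed, a neighbour is determined by its added cell, so the neighbours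
     inject into one set [A_max]. *)
  rewrite -(@card_in_imset _ _ (fun mu => (f mu).2)).
    apply: (star_capacity_ge _ _ _ _ _ (fP _ ms0)) => _ /imsetP[mu ms ->].
    have := fP _ ms; rewrite (eqP (same _ ms)) => S.
    by rewrite inE (swap_addable _ _ _ _ S) (swap_admissible _ _ _ _ S).
  move=> mu nu ms ns e; have := fP _ ns; have := fP _ ms.
  by rewrite (eqP (same _ ms)) (eqP (same _ ns)) e; apply: swap_inj.
rewrite negb_forall_in => /exists_inP[nu ns nu_ne]; apply/orP; right.
(* [nu] and [mu0] have different removed cells, hence the same added cell. The removed cell of [mu]
   differs from that of [nu] or of [mu0], so [mu] has this added cell too. *)
have same mu : mu \in sigma :\ lam -> (f mu).2 = (f mu0).2.
  move=> ms; have [en|en] := share _ _ ns ms0; first by rewrite en eqxx in nu_ne.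
  have [e0|//] := share _ _ ms ms0.
  have [e1|->//] := share _ _ ms ns.
  by rewrite -e1 e0 eqxx in nu_ne.
rewrite -(@card_in_imset _ _ (fun mu => (f mu).1)).
  apply: (top_capacity_ge _ _ _ _ _ (fP _ ms0)) => _ /imsetP[mu ms ->].
  have := fP _ ms; rewrite (same _ ms) => S.
  by rewrite inE (swap_removable _ _ _ _ S) (swap_admissible _ _ _ _ S).
move=> mu1 mu2 ms1 ms2 e; have := fP _ ms2; have := fP _ ms1.
by rewrite (same _ ms1) (same _ ms2) e; apply: swap_inj.
Qed.

(** * Lower bound: cliques realising the capacities *)

(** Adjacent partitions are distinct, so [g] is injective on [B] and avoids [lam]; thus [lam] and
    the values of [g] on [B] form a clique with [#|B| + 1] vertices. *)
Lemma dim_loc_ge_family lam (B : {set cell n}) (g : cell n -> Par n) :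
    (forall x, x \in B -> adjacent lam (g x)) ->
    {in B &, forall x y, x != y -> adjacent (g x) (g y)} ->
  #|B| <= dim_loc lam.
Proof.
move=> adj_lam adj.
have adj_sym mu nu : adjacent mu nu -> adjacent nu mu.
  by rewrite /adjacent eq_sym orbC.
have g_inj : {in B &, injective g}.
  move=> x y xB yB e; apply/eqP/negPn/negP => xy.
  by have := adj _ _ xB yB xy; rewrite e /adjacent eqxx.
have lamN : lam \notin g @: B.
  apply/imsetP => -[x xB e]; have := adj_lam _ xB.
  by rewrite -e /adjacent eqxx.
have <- : dim (lam |: g @: B) = #|B|.
  by rewrite /dim cardsU1 lamN add1n /= card_in_imset.
apply: (@leq_bigmax_cond _ (fun sigma => simplex sigma && (lam \in sigma))
  (@dim n)).
rewrite setU11 andbT /simplex; apply/andP; split.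
  by apply/set0Pn; exists lam; rewrite setU11.
apply/forall_inP => mu ms; apply/forall_inP => nu ns; apply/implyP => mn.
case/setU1P: ms mn => [->|/imsetP[x xB ->]];
  case/setU1P: ns => [->|/imsetP[y yB ->]] mn.
- by rewrite eqxx in mn.
- exact: adj_lam.
- exact/adj_sym/adj_lam.
by apply: adj => //; apply: contra_neq mn => ->.
Qed.

(** For a fixed removed corner, the results of any two admissible transfers differ by exchanging
    their added cells, so they form a clique with [lam]. *)
Lemma star_capacity_le lam : star_capacity lam <= dim_loc lam.
Proof.
apply/bigmax_leqP => c rc.
have ex a : exists mu, a \in A_max lam c -> swap lam mu c a.
  case: (boolP (a \in A_max lam c)) => [|_]; last by exists lam.
  by rewrite inE => /andP[aa ad]; have [mu S] := admissible_swap _ _ _ rc aa ad; exists mu.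
have [g gP] := fin_all_exists ex.
apply: (dim_loc_ge_family lam _ g) => [a aA|a b aA bA ab]; apply/adjacentP.
  by exists c, a; apply: gP.
by exists a, b; apply: swap_same_removed ab; apply: gP.
Qed.

Lemma top_capacity_le lam : top_capacity lam <= dim_loc lam.
Proof.
apply/bigmax_leqP => a aa.
have ex c : exists mu, c \in C_max lam a -> swap lam mu c a.
  case: (boolP (c \in C_max lam a)) => [|_]; last by exists lam.
  by rewrite inE => /andP[rc ad]; have [mu S] := admissible_swap _ _ _ rc aa ad; exists mu.
have [g gP] := fin_all_exists ex.
apply: (dim_loc_ge_family lam _ g) => [c cC|c d cC dC cd]; apply/adjacentP.
  by exists c, a; apply: gP.
(* The order is reversed: [g c] lacks [c] and still has [d], so passing to [g d] removes [d] and
   restores [c]. *)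
by exists d, c; apply: swap_same_added cd; apply: gP.
Qed.

Lemma dim_locE lam : dim_loc lam = maxn (star_capacity lam) (top_capacity lam).
Proof.
by apply/eqP; rewrite eqn_leq dim_loc_le geq_max star_capacity_le top_capacity_le.
Qed.

End PartitionGraph.

Theorem proposition3p2 (n : nat) (hn : 1 <= n) (lam : Par n) (r : nat) :
  [/\ lam \in layer n r <-> maxn (star_capacity lam) (top_capacity lam) = r,
      r <= dim_loc lam <-> (r <= star_capacity lam \/ r <= top_capacity lam)
    & dim_loc lam <= r <-> (star_capacity lam <= r /\ top_capacity lam <= r)].
Proof.
rewrite inE dim_locE; split.
- by split=> /eqP.
- by rewrite leq_max; split=> /orP.
by rewrite geq_max; split=> /andP.
Qed.
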